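(* Let $t(n)$ be a sequence of natural numbers, let $\mathrm{GF}_t(z)=\sum_{i=0}^\infty t(i)z^i$ be its generating function and let $R$ be the radius of convergence of $\mathrm{GF}_t(z)$ at zero. Let $b$, $m$, $n$ be integers such that $b\ge 2$, $n\ge m\ge 2$, $b^{-m}<R$, and $t(r)<b^{r-2}$ for every integer $r\ge m$. Then $$t(n)=\left\lfloor b^{n^2}\,\mathrm{GF}_t(b^{-n})\right\rfloor \bmod b^n .$$
   Context: Natural numbers are the non-negative integers. $\mathrm{GF}_t(b^{-n})$ denotes the (real) sum of the power series $\sum_{i\ge 0} t(i) b^{-ni}$. For an integer $y\ge 1$, $x \bmod y$ denotes the least non-negative residue of $x$ modulo $y$. *)

(* Defs.v *)
From Stdlib Require Import Reals ZArith.
From Coquelicot Require Import Coquelicot.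

Open Scope R_scope.

Definition coeffs (t : nat -> nat) : nat -> R := fun i => INR (t i).

Definition GF (t : nat -> nat) (z : R) : R := PSeries (coeffs t) z.

Definition GF_radius (t : nat -> nat) : Rbar := CV_radius (coeffs t).

(* Main.v *)
(** Multiplying [GF t (b^-n)] by [b^(n^2)] turns the terms of index [i < n] into
    multiples of [b^n], the term of index [n] into [t n], and the remaining terms
    into the sum over [k] of [t (n+1+k) b^(-n(k+1))]. Since
    [t (n+1+k) <= b^(n-1+k) - 1], this tail is at most
    [1 / (b - b^(2-n)) - 1 / (b^n - 1)], which is less than 1. *)

Require Import Defs.
From Stdlib Require Import Reals ZArith Lra Lia.
From Coquelicot Require Import Coquelicot.

Open Scope R_scope.

(** Horner's scheme in base [c]: passing from [n] to [S n] multiplies the previous value by [c], so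
    the old digit [t n] is absorbed into the multiple of [c], and [t (S n)] is added. *)
Lemma scaled_partial_sum_digit (t : nat -> nat) (c n : nat) (hc : (0 < c)%nat) :
  exists K : nat,
    INR c ^ n * sum_f_R0 (fun k => INR (t k) * (/ INR c) ^ k) n
    = INR (t n) + INR c * INR K.
Proof.
  assert (c0 : INR c <> 0) by (apply not_0_INR; lia).
  induction n as [|n [K IH]].
  - exists 0%nat; simpl; ring.
  - exists (t n + c * K)%nat.
    rewrite tech5, Rmult_plus_distr_l.
    replace (INR c ^ S n * (INR (t (S n)) * (/ INR c) ^ S n)) with (INR (t (S n)))
      by (rewrite pow_inv; field; now apply pow_nonzero).
    change (INR c ^ S n) with (INR c * INR c ^ n).
    rewrite Rmult_assoc, IH, plus_INR, mult_INR; ring.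
Qed.

(** Integrality sharpens the hypothesis to [u k + 1 <= b ^ (n - 1 + k)]. The gain of 1 matters: for
    [b = n = 2] the majorant without it sums to exactly 1. *)
Lemma geometric_tail_bounds (u : nat -> nat) (b n : nat)
  (hb : (2 <= b)%nat) (hn : (2 <= n)%nat)
  (hu : forall k, (u k < b ^ (n - 1 + k))%nat) :
  0 <= Series (fun k => INR (u k) * (/ INR b ^ n) ^ S k) < 1.
Proof.
  set (B := INR b).
  assert (B2 : 2 <= B) by (apply (le_INR 2); exact hb).
  assert (NB : B * B <= B ^ n).
  { replace (B * B) with (B ^ 2) by ring. apply Rle_pow; [lra | exact hn]. }
  set (N := B ^ n) in *.
  assert (N4 : 4 <= N) by nra.
  set (x := / N).
  assert (x0 : 0 < x) by (apply Rinv_0_lt_compat; lra).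
  assert (xN : x * N = 1) by (apply Rinv_l; lra).
  assert (x1 : x < 1) by nra.
  assert (BBx : B * (B * x) <= 1) by nra.
  assert (Bx : B * x <= / 2) by nra.
  (* This is [(B ^ (n - 1 + k) - 1) * x ^ S k] split into two geometric terms by means of
     [x * N = 1]. *)
  set (w := fun k => / B * (B * x) ^ k - x * x ^ k).
  assert (wsum : is_series w (/ B * / (1 - B * x) - x * / (1 - x))).
  { apply (is_series_minus (fun k => / B * (B * x) ^ k) (fun k => x * x ^ k)).
    - apply (is_series_scal_l (/ B) (fun k => (B * x) ^ k)), is_series_geom.
      rewrite Rabs_pos_eq; nra.
    - apply (is_series_scal_l x (fun k => x ^ k)), is_series_geom.
      rewrite Rabs_pos_eq; nra. }
  assert (uw : forall k, 0 <= INR (u k) * x ^ S k <= w k).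
  { intros k.
    assert (xk : 0 < x ^ S k) by now apply pow_lt.
    split; [apply Rmult_le_pos; [apply pos_INR | lra] |].
    assert (ub : INR (u k) + 1 <= B ^ (n - 1 + k)).
    { rewrite <- S_INR. unfold B. rewrite <- pow_INR. apply le_INR, hu. }
    assert (BN : B ^ (n - 1) = N / B).
    { unfold N. replace n with (S (n - 1)) at 2 by lia. simpl. field. lra. }
    replace (w k) with ((B ^ (n - 1 + k) - 1) * x ^ S k).
    - apply Rmult_le_compat_r; lra.
    - unfold w. rewrite pow_add, BN, Rpow_mult_distr. simpl.
      replace (/ B * (B ^ k * x ^ k)) with (x * N * (/ B * (B ^ k * x ^ k)))
        by (rewrite xN; ring).
      field. lra. }
  assert (exu : ex_series (fun k => INR (u k) * x ^ S k)).
  { apply (ex_series_le (K := R_AbsRing) (V := R_CompleteNormedModule) _ w).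
    - intros k. change (norm (INR (u k) * x ^ S k)) with (Rabs (INR (u k) * x ^ S k)).
      rewrite Rabs_pos_eq; apply uw.
    - eexists; exact wsum. }
  split.
  (* Writing 0 as 0 times the series turns the lower bound into a termwise comparison. *)
  - rewrite <- (Rmult_0_l (Series (fun k => INR (u k) * x ^ S k))).
    rewrite <- Series_scal_l.
    apply Series_le; [| exact exu].
    intros k. specialize (uw k). lra.
  - apply Rle_lt_trans with (Series w).
    + apply Series_le; [exact uw | eexists; exact wsum].
    + rewrite (is_series_unique _ _ wsum).
      (* The denominator [B - B * B * x] is at least 2 - 1, by [B2] and [BBx]; strictness then comes
         from the subtracted series. *)
      assert (/ B * / (1 - B * x) <= 1).
      { rewrite <- Rinv_mult, <- Rinv_1. apply Rinv_le_contravar; nra. }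
      assert (0 < x * / (1 - x)).
      { apply Rmult_lt_0_compat; [lra | apply Rinv_0_lt_compat; lra]. }
      lra.
Qed.

Theorem theorem4p1 (t : nat -> nat) (b m n : nat)
  (hb : (2 <= b)%nat)
  (hm : (2 <= m)%nat)
  (hmn : (m <= n)%nat)
  (hR : Rbar_lt (Finite (/ (INR b ^ m))) (GF_radius t))
  (ht : forall r : nat, (m <= r)%nat -> (t r < b ^ (r - 2))%nat) :
  Z.of_nat (t n) =
    (Int_part (INR b ^ (n ^ 2) * GF t (/ (INR b ^ n)))
       mod (Z.of_nat b ^ Z.of_nat n))%Z.
Proof.
  assert (B2 : 2 <= INR b) by (apply (le_INR 2); exact hb).
  assert (N0 : 0 < INR b ^ n) by (apply pow_lt; lra).
  assert (conv : ex_series (fun k => INR (t k) * (/ INR b ^ n) ^ k)).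
  { apply ex_pseries_R, CV_radius_inside.
    eapply Rbar_le_lt_trans; [| exact hR]. simpl.
    rewrite Rabs_pos_eq by (left; now apply Rinv_0_lt_compat).
    apply Rinv_le_contravar; [apply pow_lt; lra | apply Rle_pow; lra || lia]. }
  assert (tail : 0 <= Series (fun k => INR (t (S n + k)%nat) * (/ INR b ^ n) ^ S k) < 1).
  { apply geometric_tail_bounds; [lia | lia |].
    intros k. replace (n - 1 + k)%nat with (S n + k - 2)%nat by lia.
    apply ht. lia. }
  (* The base is [b ^ n], because the scaling factor [b ^ (n ^ 2)] is its [n]-th power. *)
  destruct (scaled_partial_sum_digit t (b ^ n) n) as [K HK].
  { apply Nat.neq_0_lt_0, Nat.pow_nonzero. lia. }
  rewrite pow_INR in HK.
  assert (value : INR b ^ (n ^ 2) * GF t (/ INR b ^ n) =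
    INR (t n) + INR b ^ n * INR K
    + Series (fun k => INR (t (S n + k)%nat) * (/ INR b ^ n) ^ S k)).
  { unfold GF, PSeries, coeffs.
    rewrite (Series_incr_n _ (S n)) by (lia || exact conv).
    replace (n ^ 2)%nat with (n * n)%nat by (simpl; lia).
    rewrite pow_mult, Rmult_plus_distr_l. simpl pred. rewrite HK. f_equal.
    rewrite <- Series_scal_l. apply Series_ext. intros k.
    (* Only the exponent is regrouped, so that its first [n] factors cancel the scaling. *)
    replace (S n + k)%nat with (n + S k)%nat at 2 by lia.
    rewrite pow_add, (pow_inv (INR b ^ n) n).
    field. repeat apply pow_nonzero. lra. }
  assert (floor : (Z.of_nat (t n) + Z.of_nat b ^ Z.of_nat n * Z.of_nat K)%Z =
    Int_part (INR b ^ (n ^ 2) * GF t (/ INR b ^ n))).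
  { apply Int_part_spec. rewrite value, plus_IZR, mult_IZR, <- pow_IZR, <- !INR_IZR_INZ.
    lra. }
  rewrite <- floor.
  assert (small : (t n < b ^ n)%nat).
  { apply Nat.lt_le_trans with (b ^ (n - 2))%nat; [apply ht, hmn |].
    apply Nat.pow_le_mono_r; lia. }
  (* [K] is the quotient, and [small] makes [t n] the remainder. *)
  apply Z.mod_unique with (Z.of_nat K); [left | ring].
  rewrite <- Nat2Z.inj_pow. lia.
Qed.
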